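(* Let $K$ be any regular polygonal knot diagram, with any folding information $F$. Then there is a constant $M>0$ such that for all widths $w<M$, the corresponding folded ribbon knot $K_w$ has only single and double points (i.e. every point of the plane is covered by at most two points of the ribbon).
   Context: A polygonal knot has finitely many vertices $v_1,\dots,v_n$ and edges $e_1=[v_1,v_2],\dots,e_n=[v_n,v_1]$. A polygonal knot diagram is a projection of a polygonal knot to a plane in which the crossing information of overlapping strands is preserved. It is regular if no three points on the knot project to the same point and no vertex projects to the same point as any other point on the knot. Given an oriented polygonal knot diagram $K$, the fold angle at $v_i$ is the angle $\theta_i\in[0,\pi]$ between $e_{i-1}$ and $e_i$. The folded ribbon knot $K_w$ of width $w$ with centerline $K$ is constructed as follows: at each vertex with $\theta_i<\pi$ place a fold line of length $w/\cos(\theta_i/2)$ centered at $v_i$ and perpendicular to the bisector of $\theta_i$ (no fold line if $\theta_i=\pi$); then add the ribbon boundaries by joining the ends of the fold lines at $v_i$ and $v_{i+1}$. Thus the ribbon is an annulus or Möbius band mapped to the plane, with the piece of ribbon belonging to $e_i$ centered on $e_i$. At each fold one chooses whether the piece of ribbon of $e_i$ lies over (overfold) or under (underfold) the piece of ribbon of $e_{i-1}$; these choices constitute the folding information $F$. Widths are non-negative real numbers; the case $w=0$ is interpreted as the diagram $K$ itself. *)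

(* Defs.v *)
From HB Require Import structures.
From mathcomp Require Import all_boot all_order all_algebra.
From mathcomp Require Import all_classical all_reals all_analysis.

Set Implicit Arguments.
Unset Strict Implicit.
Unset Printing Implicit Defensive.

Import Order.TTheory GRing.Theory Num.Theory.
Local Open Scope ring_scope.

(** * Euclidean geometry *)

(* The library norm on row vectors is the sup norm, hence [enorm]. *)
Definition dot (R : realType) (d : nat) (u v : 'rV[R]_d) : R :=
  \sum_(k < d) u 0 k * v 0 k.

Definition enorm (R : realType) (d : nat) (u : 'rV[R]_d) : R :=
  Num.sqrt (dot u u).

Definition normalize (R : realType) (d : nat) (u : 'rV[R]_d) : 'rV[R]_d :=
  (enorm u)^-1 *: u.

(* Counterclockwise quarter turn; [rot u] points to the left of [u]. *)
Definition rot (R : realType) (u : 'rV[R]_2) : 'rV[R]_2 :=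
  \row_(k < 2) (if k == 0 then - u 0 1 else u 0 0).

Definition angle (R : realType) (d : nat) (u v : 'rV[R]_d) : R :=
  acos (dot u v / (enorm u * enorm v)).

Definition segment_at (R : realType) (d : nat) (a b : 'rV[R]_d) (t : R)
  : 'rV[R]_d := (1 - t) *: a + t *: b.

(** * Polygonal knots and their diagrams *)

(* Vertices are indexed cyclically and edge [i] is [v_i, v_(i+1)], where
   [ordS] is the cyclic successor; the order of the vertices is the
   orientation.  The last field says that the closed polygon is simple. *)
Record polygonal_knot (R : realType) := PolygonalKnot {
  size_knot : nat;
  vertex : 'I_size_knot -> 'rV[R]_3;
  size_knot_gt0 : (0 < size_knot)%N;
  knot_simple : forall (i j : 'I_size_knot) (t u : R),
    0 <= t < 1 -> 0 <= u < 1 ->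
    segment_at (vertex i) (vertex (ordS i)) t =
    segment_at (vertex j) (vertex (ordS j)) u ->
    i = j /\ t = u
}.

Definition on_knot (R : realType) (K : polygonal_knot R) (x : 'rV[R]_3) : Prop :=
  exists (i : 'I_(size_knot K)) (t : R),
    0 <= t <= 1 /\ x = segment_at (vertex i) (vertex (ordS i)) t.

(* The columns of [frame] are an orthonormal basis of the plane of projection
   and [x *m frame] gives the coordinates in it of the orthogonal projection of
   [x].  The cross product of the columns is the viewing direction, so that
   keeping the knot in space records which strand is over at each crossing. *)
Record knot_diagram (R : realType) := KnotDiagram {
  space_knot :> polygonal_knot R;
  frame : 'M[R]_(3, 2);
  frame_orthonormal : frame^T *m frame = 1%:M
}.

Definition proj (R : realType) (D : knot_diagram R) (x : 'rV[R]_3) : 'rV[R]_2 :=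
  x *m frame D.

Definition regular_diagram (R : realType) (D : knot_diagram R) : Prop :=
  (forall x y z : 'rV[R]_3, on_knot D x -> on_knot D y -> on_knot D z ->
     x <> y -> y <> z -> x <> z -> ~ (proj D x = proj D y /\ proj D y = proj D z))
  /\
  (forall (i : 'I_(size_knot D)) (x : 'rV[R]_3), on_knot D x -> x <> vertex i ->
     proj D x <> proj D (vertex i)).

(** * Fold angles and folding information *)

Definition dvertex (R : realType) (D : knot_diagram R) (i : 'I_(size_knot D))
  : 'rV[R]_2 := proj D (vertex i).

Definition dedge (R : realType) (D : knot_diagram R) (i : 'I_(size_knot D))
  : 'rV[R]_2 := dvertex (ordS i) - dvertex i.

(* The two edges at [v_i] both point away from [v_i], so that a straight vertex
   has fold angle [pi]. *)
Definition fold_angle (R : realType) (D : knot_diagram R)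
    (i : 'I_(size_knot D)) : R :=
  angle (- dedge (ord_pred i)) (dedge i).

(* [overfold]: the ribbon of the outgoing edge lies over that of the incoming
   edge. *)
Inductive fold_choice := overfold | underfold.

Definition folding_information (R : realType) (D : knot_diagram R) : Type :=
  {i : 'I_(size_knot D) | fold_angle i < pi} -> fold_choice.

(** * Folded ribbon knots *)

Definition bisector (R : realType) (D : knot_diagram R) (i : 'I_(size_knot D))
  : 'rV[R]_2 :=
  normalize (- dedge (ord_pred i)) + normalize (dedge i).

(* At a fold, [v_i + s *: cross_cut i] with [`|s| <= w / 2] traces the fold line
   of length [w / cos (theta / 2)].  At a straight vertex there is no fold line
   and the ribbon runs on as a strip of width [w]; its perpendicular cross
   section at [v_i] then separates the pieces of the two edges. *)
Definition cross_cut (R : realType) (D : knot_diagram R) (i : 'I_(size_knot D))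
  : 'rV[R]_2 :=
  if fold_angle i < pi
  then (cos (fold_angle i / 2))^-1 *: normalize (rot (bisector i))
  else normalize (rot (dedge i)).

Definition to_left (R : realType) (e u : 'rV[R]_2) : 'rV[R]_2 :=
  if 0 <= dot (rot e) u then u else - u.

(* The cross cuts at both ends of edge [i], directed to the left of that edge:
   each boundary of the piece of ribbon joins two ends lying on the same side of
   the edge. *)
Definition cut_start (R : realType) (D : knot_diagram R) (i : 'I_(size_knot D))
  : 'rV[R]_2 := to_left (dedge i) (cross_cut i).

Definition cut_end (R : realType) (D : knot_diagram R) (i : 'I_(size_knot D))
  : 'rV[R]_2 := to_left (dedge i) (cross_cut (ordS i)).

Record folded_ribbon_knot (R : realType) := FoldedRibbonKnot {
  centerline : knot_diagram R;
  folding : folding_information centerline;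
  width : R
}.

(* The ribbon is obtained from rectangles [0, 1] x [- w / 2, w / 2], one for each
   edge, glued cyclically along their ends: an annulus or a Moebius band, and a
   circle when [w = 0].  A [ribbon_coord] is a point of one of the rectangles;
   [same_ribbon_point] is the equality of points after gluing. *)
Record ribbon_coord (R : realType) (n : nat) := RibbonCoord {
  piece : 'I_n;
  along : R;
  across : R
}.

Definition on_ribbon (R : realType) (K : folded_ribbon_knot R)
    (x : ribbon_coord R (size_knot (centerline K))) : Prop :=
  0 <= along x <= 1 /\ - (width K / 2) <= across x <= width K / 2.

Definition ribbon_map (R : realType) (K : folded_ribbon_knot R)
    (x : ribbon_coord R (size_knot (centerline K))) : 'rV[R]_2 :=
  segment_at (dvertex (piece x) + across x *: cut_start (piece x))
             (dvertex (ordS (piece x)) + across x *: cut_end (piece x))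
             (along x).

(* The last point of edge [i] and the first point of edge [i + 1] are glued when
   they are the same point of the cross cut at [v_(i+1)]. *)
Definition glued (R : realType) (K : folded_ribbon_knot R)
    (x y : ribbon_coord R (size_knot (centerline K))) : Prop :=
  [/\ piece y = ordS (piece x), along x = 1, along y = 0 &
      across x *: cut_end (piece x) = across y *: cut_start (piece y)].

Definition same_ribbon_point (R : realType) (K : folded_ribbon_knot R)
    (x y : ribbon_coord R (size_knot (centerline K))) : Prop :=
  x = y \/ glued x y \/ glued y x.

Definition only_single_and_double_points (R : realType)
    (K : folded_ribbon_knot R) : Prop :=
  forall (p : 'rV[R]_2) (x y z : ribbon_coord R (size_knot (centerline K))),
    on_ribbon x -> on_ribbon y -> on_ribbon z ->
    ribbon_map x = p -> ribbon_map y = p -> ribbon_map z = p ->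
    same_ribbon_point x y \/ same_ribbon_point y z \/ same_ribbon_point x z.

(* Main.v *)
(* By regularity, a point of the diagram lying on two edges comes either from a
   crossing, which has no further preimage, or from a vertex, which lies on its
   two edges only; so three distinct edges never meet.  By compactness three
   distinct edges then stay uniformly far from having a common point, hence for
   small [w] no point of the plane lies on three distinct pieces of ribbon.  As
   the cross cuts are transversal to the edges, each single piece is embedded for
   small [w], so three points of the ribbon over one point cannot be distinct. *)
From Pilot Require Import Defs.
From mathcomp Require Import all_boot all_order all_algebra.
From mathcomp Require Import all_classical all_reals all_analysis.
From mathcomp Require Import ring lra.
Set Implicit Arguments.
Unset Strict Implicit.
Unset Printing Implicit Defensive.

(* [seq.rot] would otherwise shadow [Defs.rot]. *)
Import Pilot.Defs.
Import Order.TTheory GRing.Theory Num.Theory.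
Import numFieldNormedType.Exports.
Local Open Scope ring_scope.

(** * Dot product and quarter turn in the plane *)

Lemma dot2E (R : realType) (u v : 'rV[R]_2) :
  dot u v = u 0 0 * v 0 0 + u 0 1 * v 0 1.
Proof.
rewrite /dot !big_ord_recl big_ord0 addr0.
by rewrite (_ : lift ord0 ord0 = 1) //; apply/val_inj.
Qed.

Lemma rot0E (R : realType) (u : 'rV[R]_2) : rot u 0 0 = - u 0 1.
Proof. by rewrite mxE eqxx. Qed.

Lemma rot1E (R : realType) (u : 'rV[R]_2) : rot u 0 1 = u 0 0.
Proof. by rewrite mxE. Qed.

Definition plane_coordE := (dot2E, rot0E, rot1E, mxE).

Lemma dot_rot_rot (R : realType) (u v : 'rV[R]_2) :
  dot (rot u) (rot v) = dot u v.
Proof. by rewrite !(dot2E, rot0E, rot1E); ring. Qed.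

Lemma dotNl (R : realType) (u v : 'rV[R]_2) : dot (- u) v = - dot u v.
Proof. by rewrite !plane_coordE; ring. Qed.

Lemma dotDr (R : realType) (u v v' : 'rV[R]_2) :
  dot u (v + v') = dot u v + dot u v'.
Proof. by rewrite !plane_coordE; ring. Qed.

Lemma dotZr (R : realType) (a : R) (u v : 'rV[R]_2) :
  dot u (a *: v) = a * dot u v.
Proof. by rewrite !plane_coordE; ring. Qed.

Lemma dotC (R : realType) (u v : 'rV[R]_2) : dot u v = dot v u.
Proof. by rewrite !dot2E; ring. Qed.

Lemma dot_gt0 (R : realType) (u : 'rV[R]_2) : u != 0 -> 0 < dot u u.
Proof.
move=> u0; rewrite lt_neqAle dot2E -!expr2 addr_ge0 ?sqr_ge0// andbT eq_sym.
apply: contra u0; rewrite paddr_eq0 ?sqr_ge0// !sqrf_eq0 => /andP[/eqP a /eqP b].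
apply/eqP/rowP => k; rewrite mxE.
by case: k => -[|[|//]] k; [rewrite -[RHS]a|rewrite -[RHS]b]; congr (u _ _);
  apply/val_inj.
Qed.

Lemma dot_neq0_neq0 (R : realType) (u v : 'rV[R]_2) : dot u v != 0 -> v != 0.
Proof. by apply: contraNneq => ->; rewrite !plane_coordE !mulr0 addr0. Qed.

Lemma rot_neq0 (R : realType) (u : 'rV[R]_2) : u != 0 -> rot u != 0.
Proof.
by move=> /dot_gt0; rewrite -dot_rot_rot => /lt0r_neq0/dot_neq0_neq0.
Qed.

Lemma enorm_gt0 (R : realType) (u : 'rV[R]_2) : u != 0 -> 0 < enorm u.
Proof. by move=> /dot_gt0; rewrite sqrtr_gt0. Qed.

Lemma enormK (R : realType) (u : 'rV[R]_2) : u != 0 -> dot u u = enorm u ^+ 2.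
Proof. by move=> /dot_gt0/ltW u0; rewrite sqr_sqrtr. Qed.

(** * Cosines, fold angles and bisectors *)

Definition cosine (R : realType) (u v : 'rV[R]_2) : R :=
  dot u v / (enorm u * enorm v).

Lemma cosineC (R : realType) (u v : 'rV[R]_2) : cosine u v = cosine v u.
Proof. by rewrite /cosine dotC [enorm u * _]mulrC. Qed.

(* Lagrange's identity: [(u . v)^2 + (rot u . v)^2 = |u|^2 |v|^2] *)
Lemma cosine_itv (R : realType) (u v : 'rV[R]_2) :
  u != 0 -> v != 0 -> -1 <= cosine u v <= 1.
Proof.
move=> u0 v0; rewrite -ler_norml -(expr_le1 (n := 2))// real_normK ?num_real//.
rewrite expr_div_n exprMn -!enormK// ler_pdivrMr ?mulr_gt0 ?dot_gt0// mul1r.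
rewrite -subr_ge0 (_ : _ - _ = dot (rot u) v ^+ 2) ?sqr_ge0//.
by rewrite !(dot2E, rot0E, rot1E); ring.
Qed.

(** Trades [acos] for an algebraic condition: by [cosine_itv], the only other case is cosine -1,
    where [acos] is [pi]. *)
Lemma angle_lt_pi (R : realType) (u v : 'rV[R]_2) :
  u != 0 -> v != 0 -> (angle u v < pi) = (-1 < cosine u v).
Proof.
move=> u0 v0; rewrite /angle -/(cosine u v).
have /andP[c1 c2] := cosine_itv u0 v0.
have [c3|c3] := ltP (-1) (cosine u v); first by rewrite acos_ltpi ?c3.
have -> : cosine u v = -1 by apply/eqP; rewrite eq_le c3.
by rewrite acosN1 ltxx.
Qed.

Lemma cos_half_angle_gt0 (R : realType) (u v : 'rV[R]_2) :
  u != 0 -> v != 0 -> angle u v < pi -> 0 < cos (angle u v / 2).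
Proof.
move=> u0 v0 a; apply: cos_gt0_pihalf.
have := acos_ge0 (cosine_itv u0 v0); rewrite -/(angle u v) => a0.
by have := pi_gt0 R; lra.
Qed.

(** The product of [u] with [normalize v] is [enorm u] times the cosine. Hence the bisector is
    orthogonal to [u] only when the cosine is -1, that is, at a straight vertex. *)
Lemma dot_bisector (R : realType) (u v : 'rV[R]_2) : u != 0 -> v != 0 ->
  dot u (normalize u + normalize v) = enorm u * (1 + cosine u v).
Proof.
move=> u0 v0; have := lt0r_neq0 (enorm_gt0 u0); have := lt0r_neq0 (enorm_gt0 v0).
by move=> v1 u1; rewrite /cosine dotDr !dotZr enormK//; field; rewrite u1 v1.
Qed.

(** * Transversal cuts and injectivity of a single strip *)

Lemma to_left_gt0 (R : realType) (e u : 'rV[R]_2) :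
  dot (rot e) u != 0 -> 0 < dot (rot e) (to_left e u).
Proof.
rewrite /to_left; case: ifPn => [u0 un0|]; first by rewrite lt_neqAle eq_sym un0.
by rewrite -ltNge dotC => u0 _; rewrite dotC dotNl oppr_gt0.
Qed.

(** Quarter turns preserve [dot], so the turned vector crosses the line of [e] as soon as [u] is not
    orthogonal to [e]. *)
Lemma dot_rot_normalize_rot_neq0 (R : realType) (e u : 'rV[R]_2) :
  dot e u != 0 -> dot (rot e) (normalize (rot u)) != 0.
Proof.
move=> eu; rewrite dotZr dot_rot_rot mulf_neq0// invr_neq0//.
by rewrite lt0r_neq0// enorm_gt0// rot_neq0// (dot_neq0_neq0 eu).
Qed.

(* With [x = dot E], [y = dot (rot E)] as coordinates, eliminating [s - s']
   between the two components of an equality of values leaves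
   [(t - t') (|E|^2 N + s' det (d, c)) = 0], [N] being the [y]-component of the
   convex combination [(1 - t) c + t d]. *)
Lemma strip_injective (R : realType) (A E c d : 'rV[R]_2) : E != 0 ->
  0 < dot (rot E) c -> 0 < dot (rot E) d ->
  \forall w \near (0 : R), forall s s' t t' : R,
    0 <= t <= 1 -> `|s'| <= w / 2 ->
    segment_at (A + s *: c) (A + E + s *: d) t =
    segment_at (A + s' *: c) (A + E + s' *: d) t' -> t = t' /\ s = s'.
Proof.
move=> E0 c0 d0.
set m := Num.min (dot (rot E) c) (dot (rot E) d).
have m0 : 0 < m by rewrite lt_min c0.
set Q := dot E d * dot (rot E) c - dot (rot E) d * dot E c.
have L0 := dot_gt0 E0.
near=> w => s s' t t' /andP[t0 t1] sw e.
(* This will give [|s' * Q| < dot E E * N] for every [t], as [m <= N]; the [+ 1] keeps the divisor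
   positive when [Q = 0]. *)
have wlt : w < dot E E * m / (`|Q| + 1).
  near: w; apply: lt_nbhsl.
  by rewrite divr_gt0 ?mulr_gt0// ltr_pwDr.
set N := (1 - t) * dot (rot E) c + t * dot (rot E) d.
have Nm : m <= N.
  have [m1 m2] : m <= dot (rot E) c /\ m <= dot (rot E) d.
    by split; rewrite ge_min lexx ?orbT.
  by rewrite /N; nra.
have N0 : 0 < N := lt_le_trans m0 Nm.
have e1 : (t - t') * dot E E + (s - s') * ((1 - t) * dot E c + t * dot E d)
    + s' * (t - t') * (dot E d - dot E c) = 0.
  move/(congr1 (dot E)): e => /eqP; rewrite -subr_eq0 => /eqP <-.
  by rewrite /segment_at !plane_coordE; ring.
have e2 : (s - s') * N + s' * (t - t') * (dot (rot E) d - dot (rot E) c) = 0.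
  move/(congr1 (dot (rot E))): e => /eqP; rewrite -subr_eq0 => /eqP <-.
  by rewrite /N /segment_at !plane_coordE; ring.
have e3 : (t - t') * (dot E E * N + s' * Q) = 0.
  transitivity (((t - t') * dot E E
      + (s - s') * ((1 - t) * dot E c + t * dot E d)
      + s' * (t - t') * (dot E d - dot E c)) * N
    - ((1 - t) * dot E c + t * dot E d) *
      ((s - s') * N + s' * (t - t') * (dot (rot E) d - dot (rot E) c))).
    by rewrite /Q /N; ring.
  by rewrite e1 e2 mul0r mulr0 subrr.
have D0 : dot E E * N + s' * Q != 0.
  have h : `|s' * Q| < dot E E * N.
    apply: lt_le_trans (ler_wpM2l (ltW L0) Nm).
    move: wlt; rewrite ltr_pdivlMr ?ltr_pwDr// normrM => wlt.
    apply: le_lt_trans wlt.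
    have := normr_ge0 s'; have := normr_ge0 Q; move: sw.
    by move: `|s'| `|Q| => a b; nra.
  rewrite lt0r_neq0//; move: h; rewrite ltr_norml => /andP[h _]; lra.
have tt : t = t'.
  by apply/eqP; rewrite -subr_eq0; move/eqP: e3; rewrite mulf_eq0 (negbTE D0) orbF.
split=> //; apply/eqP; rewrite -subr_eq0; move/eqP: e2.
by rewrite tt subrr mulr0 mul0r addr0 mulf_eq0 (gt_eqF N0) orbF.
Unshelve. all: by end_near. Qed.

(** * Segments and the edges of the simple polygon in space *)

Lemma segment_at0 (R : realType) (n : nat) (a b : 'rV[R]_n) :
  segment_at a b 0 = a.
Proof. by rewrite /segment_at subr0 scale1r scale0r addr0. Qed.

Lemma segment_at1 (R : realType) (n : nat) (a b : 'rV[R]_n) :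
  segment_at a b 1 = b.
Proof. by rewrite /segment_at subrr scale1r scale0r add0r. Qed.

Section KnotEdges.
Variables (R : realType) (K : polygonal_knot R).
Implicit Types i j m : 'I_(size_knot K).

Definition edge_at i (t : R) : 'rV[R]_3 :=
  segment_at (vertex i) (vertex (ordS i)) t.

Lemma edge_at0 i : edge_at i 0 = vertex i.
Proof. exact: segment_at0. Qed.

Lemma edge_at1 i : edge_at i 1 = vertex (ordS i).
Proof. exact: segment_at1. Qed.

Lemma edge_at_on_knot i t : 0 <= t <= 1 -> on_knot K (edge_at i t).
Proof. by exists i, t. Qed.

Lemma vertex_on_knot i : on_knot K (vertex i).
Proof. by rewrite -edge_at0; apply: edge_at_on_knot; rewrite lexx ler01. Qed.

(** A degenerate edge would take the same value at the parameters 0 and 1/2, against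
    [knot_simple]. *)
Lemma vertex_ordS_neq i : vertex (ordS i) <> vertex i.
Proof.
have h0 : 0 <= (0 : R) < 1 by rewrite lexx ltr01.
have h1 : 0 <= (1 / 2 : R) < 1 by apply/andP; split; lra.
move=> e; have [|_ /eqP] := @knot_simple R K i i _ _ h0 h1; last first.
  by rewrite eq_sym mulf_eq0 invr_eq0 oner_eq0 pnatr_eq0.
by rewrite segment_at0 /segment_at e -scalerDl subrK scale1r.
Qed.

Lemma vertex_inj : injective (@vertex R K).
Proof.
have h0 : 0 <= (0 : R) < 1 by rewrite lexx ltr01.
by move=> i j e; have [|//] := @knot_simple R K i j _ _ h0 h0; rewrite !segment_at0.
Qed.

(** [knot_simple] compares parameters below 1 only; the parameter 1 is treated as the start of the
    next edge. *)
Lemma vertex_on_edge i m t :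
  0 <= t <= 1 -> edge_at i t = vertex m -> i = m \/ ordS i = m.
Proof.
have h0 : 0 <= (0 : R) < 1 by rewrite lexx ltr01.
move=> /andP[t0]; rewrite le_eqVlt => /predU1P[->|t1] e.
  by right; apply: vertex_inj; rewrite -e edge_at1.
have ht : 0 <= t < 1 by rewrite t0.
by left; have [|->//] := @knot_simple R K i m _ _ ht h0; rewrite segment_at0.
Qed.

(** Simplicity rules out a meeting with both parameters below 1, so the common point is the end of
    one of the edges. *)
Lemma edges_meet i j t u : i <> j -> 0 <= t <= 1 -> 0 <= u <= 1 ->
  edge_at i t = edge_at j u -> exists m, edge_at i t = vertex m.
Proof.
move=> ij /andP[t0]; rewrite le_eqVlt => /predU1P[->|t1].
  by exists (ordS i); rewrite edge_at1.
move=> /andP[u0]; rewrite le_eqVlt => /predU1P[->|u1] e.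
  by exists (ordS j); rewrite e edge_at1.
have ht : 0 <= t < 1 by rewrite t0.
have hu : 0 <= u < 1 by rewrite u0.
by case: ij; case: (knot_simple ht hu e).
Qed.

End KnotEdges.

(** * Triple points and cross cuts in a regular diagram *)

Section DiagramEdges.
Variables (R : realType) (D : knot_diagram R).
Hypothesis regD : regular_diagram D.
Implicit Types i j k : 'I_(size_knot D).

Definition dedge_at i (t : R) : 'rV[R]_2 :=
  segment_at (dvertex i) (dvertex (ordS i)) t.

Lemma dedge_atE i t : dedge_at i t = proj D (edge_at i t).
Proof.
by rewrite /dedge_at /edge_at /segment_at /proj mulmxDl -!scalemxAl.
Qed.

Lemma dedge_neq0 i : dedge i != 0.
Proof.
rewrite subr_eq0; apply/eqP; apply: regD.2; first exact: vertex_on_knot.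
exact: vertex_ordS_neq.
Qed.

(** The common point of edges [i] and [j] is a vertex, and regularity forces edge [k] through that
    vertex in space. Only two edges contain a given vertex, so two of the three indices would
    agree. *)
Lemma no_edge_over_common_vertex i j k t u v : i <> j -> j <> k -> i <> k ->
  0 <= t <= 1 -> 0 <= u <= 1 -> 0 <= v <= 1 ->
  edge_at i t = edge_at j u -> dedge_at k v <> dedge_at i t.
Proof.
move=> ij jk ik t01 u01 v01 e; rewrite !dedge_atE => d.
have [m em] := edges_meet ij t01 u01 e.
have ek : edge_at k v = vertex m.
  apply/eqP/negP => /negP/eqP kv.
  by case: (regD.2 m _ (edge_at_on_knot k v01) kv); rewrite d em.
have [im|im] := vertex_on_edge t01 em;
have [jm|jm] := vertex_on_edge u01 (etrans (esym e) em);
have [km|km] := vertex_on_edge v01 ek.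
all: try (by apply: ij; rewrite im jm).
all: try (by apply: jk; rewrite jm km).
all: try (by apply: ik; rewrite im km).
all: try (by apply: ij; apply: ordS_inj; rewrite im jm).
all: try (by apply: jk; apply: ordS_inj; rewrite jm km).
all: by apply: ik; apply: ordS_inj; rewrite im km.
Qed.

(** If two of the space points agree, [no_edge_over_common_vertex] excludes the third edge; if all
    are distinct, the first half of regularity applies. *)
Lemma no_triple_point_on_edges i j k t u v : i <> j -> j <> k -> i <> k ->
  0 <= t <= 1 -> 0 <= u <= 1 -> 0 <= v <= 1 ->
  ~ (dedge_at i t = dedge_at j u /\ dedge_at j u = dedge_at k v).
Proof.
move=> ij jk ik t01 u01 v01 [e1 e2].
have [e|/eqP n1] := eqVneq (edge_at i t) (edge_at j u).
  by case: (no_edge_over_common_vertex ij jk ik t01 u01 v01 e); rewrite -e2.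
have [e|/eqP n2] := eqVneq (edge_at j u) (edge_at k v).
  by case: (no_edge_over_common_vertex jk (nesym ik) (nesym ij) u01 v01 t01 e).
have [e|/eqP n3] := eqVneq (edge_at i t) (edge_at k v).
  by case: (no_edge_over_common_vertex ik (nesym jk) ij t01 v01 u01 e).
case: (regD.1 _ _ _ (edge_at_on_knot i t01) (edge_at_on_knot j u01)
  (edge_at_on_knot k v01) n1 n2 n3).
by rewrite -!dedge_atE.
Qed.

Lemma cosine_fold_gtN1 i : fold_angle i < pi ->
  0 < 1 + cosine (- dedge (ord_pred i)) (dedge i).
Proof.
by rewrite /fold_angle angle_lt_pi ?oppr_eq0 ?dedge_neq0// => ?; lra.
Qed.

(** The cross cut at a straight vertex is perpendicular to the outgoing edge and must also be
    transversal to the incoming one. Reversing the incoming edge makes the cosine at most -1, hence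
    negative. *)
Lemma dot_dedge_straight_gt0 i :
  ~~ (fold_angle i < pi) -> 0 < dot (dedge (ord_pred i)) (dedge i).
Proof.
have n0 := dedge_neq0 (ord_pred i); have n1 := dedge_neq0 i.
rewrite /fold_angle angle_lt_pi ?oppr_eq0// -leNgt /cosine dotNl => c.
rewrite ltNge; apply/negP => d; have : (0 : R) <= -1; last by lra.
apply: le_trans c; rewrite divr_ge0 ?oppr_ge0//.
by rewrite ltW// mulr_gt0 ?enorm_gt0 ?oppr_eq0.
Qed.

Lemma dot_dedge_bisector_neq0 i :
  fold_angle i < pi -> dot (dedge i) (bisector i) != 0.
Proof.
move=> /cosine_fold_gtN1; have n0 := dedge_neq0 (ord_pred i).
have n1 := dedge_neq0 i => c.
rewrite /bisector addrC dot_bisector ?oppr_eq0//.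
rewrite mulf_neq0 ?lt0r_neq0 ?enorm_gt0//.
by rewrite cosineC.
Qed.

Lemma dot_dedge_pred_bisector_neq0 i :
  fold_angle i < pi -> dot (dedge (ord_pred i)) (bisector i) != 0.
Proof.
move=> /cosine_fold_gtN1; have n0 := dedge_neq0 (ord_pred i).
have n1 := dedge_neq0 i => c.
rewrite -oppr_eq0 -dotNl /bisector dot_bisector ?oppr_eq0//.
by rewrite mulf_neq0 ?lt0r_neq0 ?enorm_gt0 ?oppr_eq0.
Qed.

(** [strip_injective] asks for cuts pointing to the same side at both ends: the bisector gives
    transversality, [to_left] the sign. *)
Lemma cut_start_gt0 i : 0 < dot (rot (dedge i)) (cut_start i).
Proof.
apply: to_left_gt0; rewrite /cross_cut; case: ifPn => [th|st].
  rewrite dotZr mulf_neq0 ?invr_neq0//.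
    by rewrite lt0r_neq0// cos_half_angle_gt0 ?oppr_eq0 ?dedge_neq0.
  exact/dot_rot_normalize_rot_neq0/dot_dedge_bisector_neq0.
by rewrite dot_rot_normalize_rot_neq0// lt0r_neq0// dot_gt0// dedge_neq0.
Qed.

Lemma cut_end_gt0 i : 0 < dot (rot (dedge i)) (cut_end i).
Proof.
apply: to_left_gt0; rewrite /cross_cut; case: ifPn => [th|st].
  rewrite dotZr mulf_neq0 ?invr_neq0//.
    by rewrite lt0r_neq0// cos_half_angle_gt0 ?oppr_eq0 ?dedge_neq0.
  apply: dot_rot_normalize_rot_neq0.
  by have := dot_dedge_pred_bisector_neq0 th; rewrite ordSK.
apply: dot_rot_normalize_rot_neq0.
by rewrite lt0r_neq0//; have := dot_dedge_straight_gt0 st; rewrite ordSK.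
Qed.

End DiagramEdges.

(** * Uniform separation of three distinct edges *)

Lemma edges_separated (R : realType) (D : knot_diagram R) :
  regular_diagram D -> forall i j k : 'I_(size_knot D),
  i <> j -> j <> k -> i <> k ->
  exists2 e : R, 0 < e & forall t u v, 0 <= t <= 1 -> 0 <= u <= 1 ->
    0 <= v <= 1 ->
    e <= `|dedge_at i t - dedge_at j u| + `|dedge_at j u - dedge_at k v|.
Proof.
move=> regD i j k ij jk ik; pose I : set R := `[0, 1]%classic.
(* Vanishes only where the three edge points coincide, so its minimum over the compact cube is
   positive and serves as [e]. *)
pose f (x : R * R * R) : R := `|dedge_at i x.1.1 - dedge_at j x.1.2| +
  `|dedge_at j x.1.2 - dedge_at k x.2|.
have I0 : (I `*` I `*` I !=set0)%classic.
  by exists (0, 0, 0); rewrite /I /= !in_itv /= lexx ler01.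
have cI : compact (I `*` I `*` I)%classic.
  by do 2?apply: compact_setX; exact: segment_compact.
have cdedge (l : 'I_(size_knot D)) : continuous (dedge_at l).
  move=> t; apply: cvgD; apply: cvgZr_tmp; last exact: cvg_id.
  by apply: cvgB; [exact: cvg_cst|exact: cvg_id].
have cf : continuous f.
  have c1 : continuous (fun x : R * R * R => x.1.1).
    by move=> x; apply: cvg_comp; exact: cvg_fst.
  have c2 : continuous (fun x : R * R * R => x.1.2).
    by move=> x; apply: cvg_comp; [exact: cvg_fst|exact: cvg_snd].
  have c3 : continuous (fun x : R * R * R => x.2).
    by move=> x; exact: cvg_snd.
  move=> x; apply: cvgD; apply: cvg_norm; apply: cvgB.
  - exact: (cvg_comp _ _ (c1 x) (cdedge i _)).
  - exact: (cvg_comp _ _ (c2 x) (cdedge j _)).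
  - exact: (cvg_comp _ _ (c2 x) (cdedge j _)).
  - exact: (cvg_comp _ _ (c3 x) (cdedge k _)).
have [x xI fmin] := compact_EVT_min I0 cI (continuous_subspaceT cf).
exists (f x).
  move: xI; rewrite inE /= => -[[/= x1 x2] x3].
  move: x1 x2 x3; rewrite /I /= !in_itv /= => x1 x2 x3.
  rewrite lt_neqAle addr_ge0 // andbT eq_sym paddr_eq0 //.
  rewrite !normr_eq0 !subr_eq0; apply/negP => /andP[/eqP e1 /eqP e2].
  exact: (no_triple_point_on_edges regD ij jk ik x1 x2 x3 (conj e1 e2)).
move=> t u v t01 u01 v01; apply: (fmin (t, u, v)).
by rewrite inE /I /= !in_itv /= t01 u01 v01.
Qed.

Lemma segment_at_shift (R : realType) (n : nat) (A B c d : 'rV[R]_n) (s t : R) :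
  segment_at (A + s *: c) (B + s *: d) t =
  segment_at A B t + s *: segment_at c d t.
Proof. by apply/rowP => l; rewrite !mxE; ring. Qed.

Lemma norm_segment_at_le (R : realType) (n : nat) (c d : 'rV[R]_n) (t : R) :
  0 <= t <= 1 -> `|segment_at c d t| <= `|c| + `|d|.
Proof.
move=> /andP[t0 t1]; apply: le_trans (ler_normD _ _) _; rewrite !normrZ.
by apply: lerD; rewrite ler_piMl// ger0_norm// ?subr_ge0// gerBl.
Qed.

(** The triangle inequality through [p] bounds the sum by [w * (a + b + b + c)], [B] being reached
    twice. *)
Lemma near_common_point (R : realType) (V : normedModType R) (p A B C : V)
    (a b c w e : R) : 0 <= w -> 0 <= a -> 0 <= b -> 0 <= c ->
  w < e / (a + b + b + c + 1) ->
  `|p - A| <= w * a -> `|p - B| <= w * b -> `|p - C| <= w * c ->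
  `|A - B| + `|B - C| < e.
Proof.
move=> w0 a0 b0 c0; rewrite ltr_pdivlMr; last by rewrite ltr_pwDr// !addr_ge0.
move=> we pA pB pC.
have := ler_distD p A B; have := ler_distD p B C.
rewrite (distrC A p) (distrC B p); move: pA pB pC we.
move: `|p - A| `|p - B| `|p - C| `|A - B| `|B - C| => xA xB xC xAB xBC.
move=> *; nra.
Qed.

(** * Pieces of ribbon of small width *)

Section RibbonPieces.
Variables (R : realType) (D : knot_diagram R).
Hypothesis regD : regular_diagram D.
Variable F : folding_information D.

Definition cut_reach (i : 'I_(size_knot D)) : R :=
  `|cut_start i| + `|cut_end i|.

(** The displacement is [across x] times a convex combination of the two cuts; the bound [w / 2] is
    relaxed to [w]. *)
Lemma ribbon_map_near_edge (w : R) (x : ribbon_coord R (size_knot D))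
    (p : 'rV[R]_2) :
  @on_ribbon R (FoldedRibbonKnot F w) x ->
  @ribbon_map R (FoldedRibbonKnot F w) x = p ->
  `|p - dedge_at (piece x) (along x)| <= w * cut_reach (piece x).
Proof.
case: x => i t s; rewrite /on_ribbon /ribbon_map /dedge_at /= => -[t01].
rewrite -ler_norml => sw <-; rewrite segment_at_shift addrC addKr normrZ.
rewrite ler_pM ?normrE//; first by have := normr_ge0 s; lra.
exact: norm_segment_at_le.
Qed.

Lemma piece_injective : \forall w \near (0 : R),
  forall x y : ribbon_coord R (size_knot D),
  @on_ribbon R (FoldedRibbonKnot F w) x ->
  @on_ribbon R (FoldedRibbonKnot F w) y -> piece x = piece y ->
  @ribbon_map R (FoldedRibbonKnot F w) x =
  @ribbon_map R (FoldedRibbonKnot F w) y -> x = y.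
Proof.
(* Finitely many edges share one neighbourhood of 0. *)
have near_inj := @filter_forall _ _ _ _ (nbhs_filter (0 : R))
  (fun i => strip_injective (dvertex i) (dedge_neq0 regD i)
     (cut_start_gt0 regD i) (cut_end_gt0 regD i)).
apply: filterS near_inj => w h [i t s] [j t' s'].
rewrite /on_ribbon /ribbon_map /= => -[t01 _] [_ sw] <-.
rewrite -ler_norml in sw.
have AE l : dvertex (ordS l) = dvertex l + dedge l :> 'rV_2.
  by rewrite /dedge addrC subrK.
by rewrite !AE => /(h i s s' t t' t01 sw)[-> ->].
Qed.

Lemma pieces_disjoint : \forall w \near (0 : R),
  forall (p : 'rV[R]_2) (x y z : ribbon_coord R (size_knot D)),
  @on_ribbon R (FoldedRibbonKnot F w) x ->
  @on_ribbon R (FoldedRibbonKnot F w) y ->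
  @on_ribbon R (FoldedRibbonKnot F w) z ->
  @ribbon_map R (FoldedRibbonKnot F w) x = p ->
  @ribbon_map R (FoldedRibbonKnot F w) y = p ->
  @ribbon_map R (FoldedRibbonKnot F w) z = p ->
  [\/ piece x = piece y, piece y = piece z | piece x = piece z].
Proof.
have reach_ge0 i : 0 <= cut_reach i by rewrite addr_ge0.
pose I := 'I_(size_knot D).
(* The triple of edges is fixed first, since the admissible width depends on it; finitely many
   triples then share one neighbourhood of 0. *)
have sep (a : I * I * I) : \forall w \near (0 : R),
    forall (p : 'rV[R]_2) (x y z : ribbon_coord R (size_knot D)),
    @on_ribbon R (FoldedRibbonKnot F w) x ->
    @on_ribbon R (FoldedRibbonKnot F w) y ->
    @on_ribbon R (FoldedRibbonKnot F w) z ->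
    @ribbon_map R (FoldedRibbonKnot F w) x = p ->
    @ribbon_map R (FoldedRibbonKnot F w) y = p ->
    @ribbon_map R (FoldedRibbonKnot F w) z = p ->
    a = (piece x, piece y, piece z) ->
    [\/ a.1.1 = a.1.2, a.1.2 = a.2 | a.1.1 = a.2].
  case: a => -[i j] k /=.
  (* A repeated index settles the claim at any width. *)
  have [ij|/eqP ij] := eqVneq i j; first by near=> w => *; apply: Or31.
  have [jk|/eqP jk] := eqVneq j k; first by near=> w => *; apply: Or32.
  have [ik|/eqP ik] := eqVneq i k; first by near=> w => *; apply: Or33.
  have [e e0 he] := edges_separated regD ij jk ik.
  near=> w => p x y z xw yw zw xp yp zp [ei ej ek]; exfalso.
  have wlt : w < e / (cut_reach i + cut_reach j + cut_reach j + cut_reach k + 1).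
    near: w; apply: lt_nbhsl.
    by rewrite divr_gt0// ltr_pwDr// !addr_ge0.
  (* The interval containing [across x] is nonempty. *)
  have w0 : 0 <= w by move: xw.2 => /=; lra.
  have px := ribbon_map_near_edge xw xp; rewrite -ei in px.
  have py := ribbon_map_near_edge yw yp; rewrite -ej in py.
  have pz := ribbon_map_near_edge zw zp; rewrite -ek in pz.
  have := le_lt_trans (he _ _ _ xw.1 yw.1 zw.1)
    (near_common_point w0 (reach_ge0 i) (reach_ge0 j) (reach_ge0 k) wlt px py pz).
  by rewrite ltxx.
have := @filter_forall _ _ _ _ (nbhs_filter (0 : R)) sep.
apply: filterS => w h p x y z xw yw zw xp yp zp.
exact: (h _ p x y z xw yw zw xp yp zp erefl).
Unshelve. all: by end_near. Qed.

End RibbonPieces.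

Theorem proposition21 (R : realType) (K : knot_diagram R)
    (hK : regular_diagram K) (F : folding_information K) :
  exists M : R, 0 < M /\
    forall w : R, 0 <= w -> w < M ->
      only_single_and_double_points (FoldedRibbonKnot F w).
Proof.
have [M /= M0 hM] := filterI (piece_injective hK F) (pieces_disjoint hK F).
exists M; split => // w w0 wM p x y z xw yw zw xp yp zp.
have [|inj disj] := hM w; first by rewrite /ball_ /= sub0r normrN ger0_norm.
(* Two of the three points lie on one piece, where [inj] makes their coordinates equal. *)
have [e|e|e] := disj p x y z xw yw zw xp yp zp.
- by left; left; exact: (inj x y xw yw e (etrans xp (esym yp))).
- by right; left; left; exact: (inj y z yw zw e (etrans yp (esym zp))).
- by right; right; left; exact: (inj x z xw zw e (etrans xp (esym zp))).
Qed.
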